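(* Let $\mathbb P$ be a partition, $P_0$ a probability on $\mathcal A(\mathbb P)$, $c\in\mathbb R$, $b>0$, and let $\overline P:\mathcal A(\mathbb P)\to\mathbb R$ be an NL$(c,b)$ upper probability (with respect to $P_0$). If $b+2c\ge 1$, then $\overline P$ is 2-coherent (as an upper probability) on $\mathcal A(\mathbb P)$.
   Context: A partition $\mathbb P$ is an arbitrary (finite or infinite) set of pairwise disjoint non-impossible events (atoms) whose logical sum is the sure event $\Omega$. $\mathcal A(\mathbb P)$ is the set of events logically dependent on $\mathbb P$, i.e. the powerset of $\mathbb P$ (events are identified with sets of atoms); $\emptyset$ is the impossible event and $\neg A$ the complement of $A$. A probability on $\mathcal A(\mathbb P)$ is a finitely additive function $P_0:\mathcal A(\mathbb P)\to[0,1]$ with $P_0(\Omega)=1$ (no countable additivity is required). $I_A$ is the indicator of the event $A$. Given $P_0$, $c\in\mathbb R$ and $b>0$, a function $\mu:\mathcal A(\mathbb P)\to\mathbb R$ is NL$(c,b)$ if $\mu(\emptyset)=0$, $\mu(\Omega)=1$, and for all $A\in\mathcal A(\mathbb P)\setminus\{\emptyset,\Omega\}$, $\mu(A)=\min\{\max\{bP_0(A)+c,0\},1\}$. A lower probability $\underline P:\mathcal A(\mathbb P)\to\mathbb R$ is 2-coherent if, for all $s_1\ge 0$, $s_0\in\mathbb R$ and $A_0,A_1\in\mathcal A(\mathbb P)$, putting $\underline G_2=s_1(I_{A_1}-\underline P(A_1))-s_0(I_{A_0}-\underline P(A_0))$, one has $\max\underline G_2\ge 0$ (maximum over atoms). An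 upper probability $\overline P:\mathcal A(\mathbb P)\to\mathbb R$ is 2-coherent if its conjugate lower probability $\underline P(A)=1-\overline P(\neg A)$ is 2-coherent. *)

(* Defs.v *)
From mathcomp Require Import all_boot all_order all_algebra.
From mathcomp Require Import boolp classical_sets reals numfun.

Set Implicit Arguments.
Unset Strict Implicit.
Unset Printing Implicit Defensive.

Import Order.TTheory GRing.Theory Num.Theory.

Local Open Scope classical_set_scope.
Local Open Scope ring_scope.

(* A partition is represented by the type [T] of its atoms, so that the events
   logically dependent on it are the sets of atoms, [set T]; [set0] and [setT]
   are the impossible and the sure event.  [T] may be infinite.  It is not
   required to be inhabited, but [finadd_probability] forces it to be. *)

Record finadd_probability (R : realType) (T : Type) (P0 : set T -> R) : Prop :=
  FinaddProbability {
    finadd_prob_ge0 : forall A, 0 <= P0 A;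
    finadd_prob_le1 : forall A, P0 A <= 1;
    finadd_prob_setT : P0 setT = 1;
    finadd_probU : forall A B, A `&` B = set0 -> P0 (A `|` B) = P0 A + P0 B }.

Record NL (R : realType) (T : Type) (P0 : set T -> R) (c b : R)
    (mu : set T -> R) : Prop :=
  IsNL {
    NL_set0 : mu set0 = 0;
    NL_setT : mu setT = 1;
    NL_mid : forall A, A <> set0 -> A <> setT ->
      mu A = Num.min (Num.max (b * P0 A + c) 0) 1 }.

Definition gain2 (R : realType) (T : Type) (lowP : set T -> R) (s1 s0 : R)
    (A1 A0 : set T) (w : T) : R :=
  s1 * (\1_A1 w - lowP A1) - s0 * (\1_A0 w - lowP A0).

Definition is_maximum (R : realType) (T : Type) (G : T -> R) (m : R) : Prop :=
  range G m /\ ubound (range G) m.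

Definition lower_2coherent (R : realType) (T : Type) (lowP : set T -> R)
    : Prop :=
  forall (s1 s0 : R) (A0 A1 : set T), 0 <= s1 ->
    exists2 m, is_maximum (gain2 lowP s1 s0 A1 A0) m & 0 <= m.

Definition conjugate (R : realType) (T : Type) (mu : set T -> R) (A : set T)
    : R :=
  1 - mu (~` A).

Definition upper_2coherent (R : realType) (T : Type) (upP : set T -> R)
    : Prop :=
  lower_2coherent (conjugate upP).

(* Main.v *)
Require Import Defs.
From mathcomp Require Import all_boot all_order all_algebra.
From mathcomp Require Import boolp classical_sets reals numfun.
From mathcomp Require Import lra.

Import Order.TTheory GRing.Theory Num.Theory.
Local Open Scope classical_set_scope.
Local Open Scope ring_scope.

(** The conjugate [L] of the upper probability is a capacity: it is monotone,
    because truncating an increasing affine image of a probability to the unit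
    interval preserves monotonicity, and it takes the values 0 and 1 at the
    impossible and the sure event.  The condition [1 <= b + 2 * c] says that the
    affine images of [A] and [~` A] add up to at least 1; truncation keeps this
    bound ([clamp01D_ge1]), and for the conjugate it reads
    [L A + L (~` A) <= 1].

    Any such capacity is 2-coherent ([lower_2coherent_capacity]).  A gain takes
    at most four values, so it has a maximum ([gain2_maximum]), and it remains to
    find one atom where the gain is nonnegative.  For [0 <= s0] (the event [A0]
    is sold), every atom of [A1] outside [A0] will do, so the only difficulty is
    [A1 `<=` A0]; then [L A1 <= L A0], and the larger of the two stakes decides
    whether to look inside [A1] or outside [A0].  For [s0 <= 0] (both events are
    bought), every common atom will do, so the only difficulty is that of
    disjoint events; then [A0 `<=` ~` A1] gives [L A1 + L A0 <= 1], and the atom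
    is taken in the event with the larger stake.  If an event is empty or sure
    and the desired atom does not exist, the values [L set0 = 0] and
    [L setT = 1] make another atom work. *)

(** * Existence of maxima *)

Lemma fin_factor_maximum (R : realType) (T : Type) (F : finType)
    (f : T -> F) (g : F -> R) (w0 : T) :
  exists m, is_maximum (g \o f) m.
Proof.
have Pw0 : `[< exists w, f w = f w0 >] by apply/asboolP; exists w0.
case: (@arg_maxP _ _ F (f w0) (fun i => `[< exists w, f w = i >]) g Pw0).
move=> i /asboolP[w fwi] max_i; exists (g i); split.
  by exists w => //=; rewrite fwi.
by move=> _ [v _ <-]; apply: max_i; apply/asboolP; exists v.
Qed.

(** The gain at an atom depends only on which of the two events contain it. *)
Lemma gain2_maximum (R : realType) (T : Type) (L : set T -> R) (s1 s0 : R)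
    (A1 A0 : set T) (w0 : T) :
  exists m, is_maximum (gain2 L s1 s0 A1 A0) m.
Proof.
pose f w := (w \in A1, w \in A0).
pose g (p : bool * bool) := s1 * (p.1%:R - L A1) - s0 * (p.2%:R - L A0).
have -> : gain2 L s1 s0 A1 A0 = g \o f.
  by apply/funext => w; rewrite /gain2 !indicE.
exact: fin_factor_maximum.
Qed.

(** * 2-coherence of capacities *)

Section Capacity.
Variables (R : realType) (T : Type) (L : set T -> R).
Hypothesis L0 : L set0 = 0.
Hypothesis LT : L setT = 1.
Hypothesis L_le : forall A B, A `<=` B -> L A <= L B.

Let L_ge0 (A : set T) : 0 <= L A.
Proof. by rewrite -L0; apply: L_le. Qed.

Let L_le1 (A : set T) : L A <= 1.
Proof. by rewrite -LT; apply: L_le. Qed.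

Let indic_in (A : set T) w : A w -> \1_A w = 1 :> R.
Proof. by move=> Aw; rewrite indicE mem_set. Qed.

Let indic_notin (A : set T) w : ~ A w -> \1_A w = 0 :> R.
Proof. by move=> Aw; rewrite indicE memNset. Qed.

Let setT_nonempty : exists w : T, True.
Proof.
have /eqP/set0P[w _] : [set: T] <> set0.
  by move=> T0; move: LT; rewrite T0 L0; lra.
by exists w.
Qed.

(** For [A1 `<=` A0], the gain is [s1 * (1 - L A1) - s0 * (1 - L A0)] inside [A1]
    and [s0 * L A0 - s1 * L A1] outside [A0].  Replacing [L A0] by the smaller
    [L A1] bounds them below by [(s1 - s0) * (1 - L A1)] and
    [(s0 - s1) * L A1]. *)
Lemma gain2_ge0_sell (s1 s0 : R) (A1 A0 : set T) : 0 <= s1 -> 0 <= s0 ->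
  exists w, 0 <= gain2 L s1 s0 A1 A0 w.
Proof.
move=> s1_ge0 s0_ge0; rewrite /gain2.
have win1 : 0 <= s1 * (1 - L A1) by rewrite mulr_ge0// subr_ge0.
have win0 : 0 <= s0 * L A0 by rewrite mulr_ge0.
have [[w [A1w A0w]]|no_w] := pselect (exists w, A1 w /\ ~ A0 w).
  by exists w; rewrite indic_in// indic_notin//; lra.
have A10 : A1 `<=` A0.
  by move=> w A1w; apply: contrapT => A0w; apply: no_w; exists w.
have leL : 0 <= s0 * (L A0 - L A1) by rewrite mulr_ge0// subr_ge0 L_le.
have [A1_0|/eqP/set0P[u A1u]] := pselect (A1 = set0).
  have [A0T|/setTPn[v A0v]] := eqVneq A0 setT.
    have [w] := setT_nonempty.
    by exists w; rewrite A1_0 A0T indic_notin// indic_in// L0 LT; lra.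
  by exists v; rewrite A1_0 indic_notin// indic_notin// L0; lra.
have A0u := A10 _ A1u.
have [s01|/ltW s10] := leP s0 s1.
  have gap : 0 <= (s1 - s0) * (1 - L A1) by rewrite mulr_ge0// subr_ge0.
  by exists u; rewrite !indic_in//; lra.
have [A0T|/setTPn[v A0v]] := eqVneq A0 setT.
  by exists u; rewrite !indic_in// A0T LT; lra.
have A1v : ~ A1 v by move/A10.
have gap : 0 <= (s0 - s1) * L A1 by rewrite mulr_ge0// subr_ge0.
by exists v; rewrite !indic_notin//; lra.
Qed.

Hypothesis L_compl : forall A, L A + L (~` A) <= 1.

(** For disjoint events and [t = - s0], the gain is [s1 * (1 - L A1) - t * L A0]
    in [A1] and [t * (1 - L A0) - s1 * L A1] in [A0].  Since [L A1 + L A0 <= 1],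
    these are at least [(s1 - t) * L A0] and [(t - s1) * L A1]. *)
Lemma gain2_ge0_buy (s1 s0 : R) (A1 A0 : set T) : 0 <= s1 -> s0 <= 0 ->
  exists w, 0 <= gain2 L s1 s0 A1 A0 w.
Proof.
move=> s1_ge0; rewrite -oppr_ge0 => t_ge0; rewrite /gain2.
have win1 : 0 <= s1 * (1 - L A1) by rewrite mulr_ge0// subr_ge0.
have win0 : 0 <= - s0 * (1 - L A0) by rewrite mulr_ge0// subr_ge0.
have [[w [A1w A0w]]|no_w] := pselect (exists w, A1 w /\ A0 w).
  by exists w; rewrite !indic_in//; lra.
have A01 : A0 `<=` ~` A1 by move=> w A0w A1w; apply: no_w; exists w.
have le1 : 0 <= 1 - L A1 - L A0.
  by have := L_le _ _ A01; have := L_compl A1; lra.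
have [A1_0|/eqP/set0P[u A1u]] := pselect (A1 = set0).
  have [A0_0|/eqP/set0P[v A0v]] := pselect (A0 = set0).
    have [w] := setT_nonempty.
    by exists w; rewrite A1_0 A0_0 !indic_notin// L0; lra.
  by exists v; rewrite A1_0 indic_notin// indic_in// L0; lra.
have A0u : ~ A0 u by move/A01.
have [A0_0|/eqP/set0P[v A0v]] := pselect (A0 = set0).
  by exists u; rewrite A0_0 indic_in// indic_notin// L0; lra.
have [s01|/ltW s10] := leP (- s0) s1.
  have gap : 0 <= (s1 - - s0) * L A0 by rewrite mulr_ge0// subr_ge0.
  have rest : 0 <= s1 * (1 - L A1 - L A0) by rewrite mulr_ge0.
  by exists u; rewrite indic_in// indic_notin//; lra.
have A1v := A01 _ A0v.
have gap : 0 <= (- s0 - s1) * L A1 by rewrite mulr_ge0// subr_ge0.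
have rest : 0 <= - s0 * (1 - L A1 - L A0) by rewrite mulr_ge0.
by exists v; rewrite indic_notin// indic_in//; lra.
Qed.

Lemma lower_2coherent_capacity : lower_2coherent L.
Proof.
move=> s1 s0 A0 A1 s1_ge0.
have [w w_ge0] : exists w, 0 <= gain2 L s1 s0 A1 A0 w.
  have [s0_ge0|/ltW s0_le0] := leP 0 s0; first exact: gain2_ge0_sell.
  exact: gain2_ge0_buy.
have [m mP] := gain2_maximum _ _ L s1 s0 A1 A0 w.
exists m => //; apply: (le_trans w_ge0).
by case: mP => _; apply; exists w.
Qed.

End Capacity.

(** * Nearly linear capacities *)

Definition clamp01 {R : realType} (x : R) : R := Num.min (Num.max x 0) 1.

Lemma clamp01_ge0 (R : realType) (x : R) : 0 <= clamp01 x.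
Proof. by rewrite /clamp01 le_min le_max lexx orbT ler01. Qed.

Lemma clamp01_le1 (R : realType) (x : R) : clamp01 x <= 1.
Proof. by rewrite /clamp01 ge_min lexx orbT. Qed.

Lemma le_clamp01 (R : realType) (x y : R) : x <= y -> clamp01 x <= clamp01 y.
Proof.
move=> xy; rewrite /clamp01 /Num.max.
by case: (ltP x 0) => ?; case: (ltP y 0) => ?;
  rewrite /Num.min; repeat case: ltP => ?; lra.
Qed.

(** Truncation decreases only an argument above 1, and then that argument alone
    still contributes 1 while the other one is made nonnegative. *)
Lemma clamp01D_ge1 (R : realType) (x y : R) :
  1 <= x + y -> 1 <= clamp01 x + clamp01 y.
Proof.
move=> xy; rewrite /clamp01 /Num.max.
by case: (ltP x 0) => ?; case: (ltP y 0) => ?;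
  rewrite /Num.min; repeat case: ltP => ?; lra.
Qed.

Section FinaddProbability.
Variables (R : realType) (T : Type) (P0 : set T -> R).
Hypothesis hP0 : finadd_probability P0.

Lemma finadd_prob_le (A B : set T) : A `<=` B -> P0 A <= P0 B.
Proof.
move=> AB; have := finadd_probU hP0 (setDIK A B).
rewrite setDUK// => ->.
by have := finadd_prob_ge0 hP0 (B `\` A); lra.
Qed.

Lemma finadd_probC (A : set T) : P0 (~` A) = 1 - P0 A.
Proof.
have := finadd_probU hP0 (setICr A).
by rewrite setUCr (finadd_prob_setT hP0); lra.
Qed.

Variables (c b : R) (mu : set T -> R).
Hypothesis hNL : NL P0 c b mu.

Lemma NL_le (A B : set T) : 0 < b -> A `<=` B -> mu A <= mu B.
Proof.
move=> b_gt0 AB.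
have mu_ge0 C : 0 <= mu C.
  have [->|C0] := pselect (C = set0); first by rewrite (NL_set0 hNL).
  have [->|CT] := pselect (C = setT); first by rewrite (NL_setT hNL).
  by rewrite (NL_mid hNL)//; apply: clamp01_ge0.
have mu_le1 C : mu C <= 1.
  have [->|C0] := pselect (C = set0); first by rewrite (NL_set0 hNL).
  have [->|CT] := pselect (C = setT); first by rewrite (NL_setT hNL).
  by rewrite (NL_mid hNL)//; apply: clamp01_le1.
have [->|A0] := pselect (A = set0); first by rewrite (NL_set0 hNL).
have [->|BT] := pselect (B = setT); first by rewrite (NL_setT hNL).
have B0 : B <> set0 by move=> B0; apply: A0; rewrite -subset0 -B0.
have AT : A <> setT by move=> AT; apply: BT; rewrite -subTset -AT.
rewrite !(NL_mid hNL)//; apply: le_clamp01.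
by rewrite lerD2r ler_pM2l// finadd_prob_le.
Qed.

Lemma NL_compl (A : set T) : 1 <= b + 2 * c -> 1 <= mu A + mu (~` A).
Proof.
move=> hbc.
have [->|A0] := pselect (A = set0).
  by rewrite setC0 (NL_set0 hNL) (NL_setT hNL); lra.
have [->|AT] := pselect (A = setT).
  by rewrite setCT (NL_set0 hNL) (NL_setT hNL); lra.
have CA0 : ~` A <> set0 by move=> CA; apply: AT; rewrite -(setCK A) CA setC0.
have CAT : ~` A <> setT by move=> CA; apply: A0; rewrite -(setCK A) CA setCT.
rewrite !(NL_mid hNL)//; apply: clamp01D_ge1.
by rewrite finadd_probC; lra.
Qed.

End FinaddProbability.

Theorem proposition3p3 (R : realType) (T : Type) (P0 : set T -> R) (c b : R)
    (upP : set T -> R)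
    (hP0 : finadd_probability P0) (hb : 0 < b) (hNL : NL P0 c b upP)
    (hbc : 1 <= b + 2 * c) :
  upper_2coherent upP.
Proof.
apply: lower_2coherent_capacity; rewrite /conjugate.
- by rewrite setC0 (NL_setT hNL) subrr.
- by rewrite setCT (NL_set0 hNL) subr0.
- move=> A B AB; rewrite lerD2l lerN2.
  by apply: (NL_le _ _ _ hP0 _ _ _ hNL) => //; apply: subsetC.
- move=> A; have := NL_compl _ _ _ hP0 _ _ _ hNL A hbc.
  by rewrite setCK; lra.
Qed.
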